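(* Let $G$ be a finite, simple, connected graph with $n$ vertices and minimum degree $\delta$. Then $rc(G)\leq n-\delta$, where $rc(G)$ denotes the rainbow connection number of $G$.
   Context: An edge-colored graph $G$ (where adjacent edges may receive the same color) is rainbow connected if any two vertices of $G$ are connected by a path whose edges have pairwise distinct colors. The rainbow connection number $rc(G)$ of a connected graph $G$ is the smallest number of colors needed to color the edges of $G$ so that $G$ becomes rainbow connected. *)

(* Defs.v *)
From mathcomp Require Import all_boot.
From mathcomp Require Import boolp.

Set Implicit Arguments.
Unset Strict Implicit.
Unset Printing Implicit Defensive.

Record sgraph := SGraph {
  vertex :> finType;
  adj : rel vertex;
  adj_sym : symmetric adj;
  adj_irr : irreflexive adj }.

Definition edges (G : sgraph) : {set {set G}} :=
  [set e | [exists x : G, exists y : G, adj x y && (e == [set x; y])]].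

Definition degree (G : sgraph) (x : G) : nat := #|[set y | adj x y]|.

(* Every degree is smaller than #|G|, so the default value #|G| is never the
   minimum when G has a vertex. *)
Definition min_degree (G : sgraph) : nat :=
  \big[minn/#|G|]_(x : G) degree x.

(* A path from x to y: a sequence of pairwise distinct vertices x :: p, with
   consecutive vertices adjacent, ending at y. *)
Definition is_path (G : sgraph) (x y : G) (p : seq G) : Prop :=
  [/\ path (@adj G) x p, uniq (x :: p) & last x p = y].

Definition connected_graph (G : sgraph) : Prop :=
  0 < #|G| /\ forall x y : G, exists p : seq G, is_path x y p.

Definition path_edges (G : sgraph) (x : G) (p : seq G) : seq {set G} :=
  pairmap (fun u v => [set u; v]) x p.

(* An edge-coloring is given by a function on all vertex sets; only its values
   on edges matter. *)
Definition rainbow_connected (G : sgraph) (c : {set G} -> nat) : Prop :=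
  forall x y : G, exists p : seq G,
    is_path x y p /\ uniq [seq c e | e <- path_edges x p].

Definition rainbow_colorable (G : sgraph) (k : nat) : Prop :=
  exists c : {set G} -> nat,
    (forall e, e \in edges G -> c e < k) /\ rainbow_connected c.

Lemma path_edges_sub (G : sgraph) (x : G) (p : seq G) :
  path (@adj G) x p -> {subset path_edges x p <= edges G}.
Proof.
elim: p x => [|y p IH] x //= /andP[xy yp] e.
rewrite inE => /orP[/eqP->|]; last exact: IH yp _.
by rewrite inE; apply/existsP; exists x; apply/existsP; exists y; rewrite xy eqxx.
Qed.

Lemma path_edges_vertex (G : sgraph) (x z : G) (p : seq G) (e : {set G}) :
  e \in path_edges x p -> z \in e -> z \in x :: p.
Proof.
elim: p x => [|y p IH] x //=; rewrite inE => /orP[/eqP->|ep ze].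
  by rewrite !inE => /orP[]->; rewrite ?orbT.
by rewrite inE (IH _ ep ze) orbT.
Qed.

Lemma path_edges_uniq (G : sgraph) (x : G) (p : seq G) :
  uniq (x :: p) -> uniq (path_edges x p).
Proof.
elim: p x => [|y p IH] x // /andP[xyp Uyp]; rewrite /= IH // andbT.
by apply: contra xyp => /path_edges_vertex; apply; rewrite !inE eqxx.
Qed.

(* Give all the edges different colors. *)
Lemma rainbow_colorable_ex (G : sgraph) :
  connected_graph G -> exists k, `[< rainbow_colorable G k >].
Proof.
case=> _ conG; exists #|edges G|; apply/asboolP.
exists (fun e => index e (enum (edges G))); split=> [e eG|x y].
  by rewrite cardE index_mem mem_enum.
have [p pP] := conG x y; exists p; split=> //; case: pP => xp Up _.
rewrite map_inj_in_uniq ?path_edges_uniq // => e f.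
move=> /(path_edges_sub xp) eG /(path_edges_sub xp) fG ef.
by rewrite -(nth_index e (s := enum (edges G)) (x := e)) ?mem_enum // ef
  nth_index ?mem_enum.
Qed.

Definition rc (G : sgraph) (conG : connected_graph G) : nat :=
  ex_minn (rainbow_colorable_ex conG).

(* Main.v *)
(** Let [N = N(x)] and let [M] be the set of vertices other than [x] that are not
    adjacent to [x].  If [x] and a connected set [K] without vertices in [N[x]]
    are chosen with [#|K|] maximal, then some [h] in [N] is adjacent to [K], and
    every [z] in [M] outside [K] is adjacent to [h]: it is not adjacent to [K], as
    [x] and [z |: K] would be a better choice, and if it were not adjacent to
    [h], then [z] and [h |: K] would be one.  So [h |: M] is connected and has a
    spanning tree, whose [#|M|] edges get distinct colors.  The edges avoiding
    [x] and not inside [h |: M] get one further color, also given to [xh].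
    A vertex [y] in [N] has at least as many neighbors in [M] as it has
    non-neighbors in [N], up to the difference [degree x - delta], so the edges
    [xy] can be colored greedily such that [xy] and [xz] differ when [y] and [z]
    are not adjacent, and such that [xy] avoids the tree colors when [y] has no
    neighbor in [M]. *)
Require Import Defs.
From mathcomp Require Import all_boot.
From mathcomp Require Import boolp zify.

Set Implicit Arguments.
Unset Strict Implicit.
Unset Printing Implicit Defensive.

(** * Greedy list coloring with one precolored vertex *)

Lemma greedy_list_coloring (T : finType) (e : rel T) (L : T -> seq nat)
    (h : T) (a : nat) (s : seq T) :
  symmetric e -> irreflexive e -> h \notin s ->
  (forall y, y \in s -> uniq (L y) /\ #|[set z | e y z]| < size (L y)) ->
  exists c : T -> nat, [/\ c h = a, forall y, y \in s -> c y \in L y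
    & forall y z, y \in h :: s -> z \in h :: s -> e y z -> c y != c z].
Proof.
move=> e_sym e_irr; elim: s => [|y s IH].
  move=> _ _; exists (fun=> a); split=> // y z.
  by rewrite !inE => /eqP-> /eqP->; rewrite e_irr.
rewrite inE negb_or => /andP[hy hs] Ls.
have [z zs|c [ch cL cP]] := IH hs; first by apply: Ls; rewrite inE zs orbT.
have [uL sL] := Ls y (mem_head _ _).
(* The list of [y] has more colors than [y] has conflicts, so some color in it is taken by none of
   them. *)
have [b bL be] : exists2 b, b \in L y & forall z, e y z -> c z != b.
  have /hasP[b bL be] : has (fun b => b \notin [seq c z | z in [set z | e y z]]) (L y).
    apply/negPn/negP; rewrite -all_predC => /allP sub.
    have /(uniq_leq_size uL) : {subset L y <= [seq c z | z in [set z | e y z]]}.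
      by move=> b /sub; rewrite /= negbK.
    by rewrite size_map -cardE leqNgt sL.
  exists b => // z yz; apply: contraNneq be => <-.
  by apply/imageP; exists z; rewrite ?inE.
exists (fun z => if z == y then b else c z); split.
- by rewrite (negPf hy).
- by move=> z; rewrite inE; case: eqP => [-> _|_ /cL].
move=> u v; have mem w : w \in h :: y :: s -> w != y -> w \in h :: s.
  by rewrite !inE => ws wy; rewrite (negPf wy) in ws.
case: (eqVneq u y) => [->|uy]; case: (eqVneq v y) => [->|vy] us vs uv.
- by rewrite e_irr in uv.
- by rewrite eq_sym be.
- by rewrite be // e_sym.
- by apply: cP; rewrite ?mem.
Qed.

(** * Rainbow paths confined to a vertex set *)

Section Rainbow.
Variable G : sgraph.
Implicit Types (x y u v w : G) (p : seq G) (D : {set G}) (c : {set G} -> nat).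

(** Confinement to [D] lets a path survive recoloring elsewhere and be extended by a vertex outside
    [D]; the bound [k] leaves all colors from [k] on free for the new edge. *)
Definition rainbow_within c D k u v : Prop :=
  exists p, [/\ is_path u v p, {subset u :: p <= D},
    uniq [seq c e | e <- path_edges u p]
    & all (gtn k) [seq c e | e <- path_edges u p]].

Lemma path_edges_rcons u p v :
  path_edges u (rcons p v) = rcons (path_edges u p) [set last u p; v].
Proof. by elim: p u => [|w p IH] u //=; rewrite -IH. Qed.

Lemma path_edges_rev u p :
  path_edges (last u p) (rev (belast u p)) = rev (path_edges u p).
Proof.
elim: p u => [|w p IH] u //=.
rewrite !rev_cons path_edges_rcons -IH; congr rcons.
by case: p {IH} => [|w' p] //=; rewrite ?rev_cons ?last_rcons setUC.
Qed.

Lemma rainbow_within_sym c D k u v :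
  rainbow_within c D k u v -> rainbow_within c D k v u.
Proof.
case=> p [[up Up lp] pD Uc kc]; exists (rev (belast u p)).
have E : v :: rev (belast u p) = rev (u :: p) by rewrite [u :: p]lastI lp rev_rcons.
split.
- split; last by rewrite -lp; case: (p) => [|w q] //=; rewrite rev_cons last_rcons.
    by rewrite -lp rev_path; under eq_path => a b do rewrite adj_sym.
  by rewrite E rev_uniq.
- by move=> w; rewrite E mem_rev; apply: pD.
- by rewrite -lp path_edges_rev map_rev rev_uniq.
by rewrite -lp path_edges_rev map_rev all_rev.
Qed.

Lemma rainbow_within_cons c D k k' u v w :
  adj u w -> u \notin D -> k <= c [set u; w] < k' ->
  rainbow_within c D k w v -> rainbow_within c (u |: D) k' u v.
Proof.
move=> uw uD /andP[kc ck] [p [[wp Up lp] pD Uc kp]]; exists (w :: p); split.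
- split=> //; first by rewrite /= uw.
  by rewrite cons_uniq Up andbT; apply: contra uD => /pD.
- by move=> z; rewrite inE => /predU1P[->|/pD zD]; rewrite !inE ?eqxx ?zD ?orbT.
- rewrite /= Uc andbT; apply/negP => /(allP kp) /=.
  by rewrite ltnNge kc.
rewrite /= ck; apply: sub_all kp => i /= ik.
exact: ltn_trans ik (leq_ltn_trans kc ck).
Qed.

Lemma path_edges_subset u p (e : {set G}) D :
  {subset u :: p <= D} -> e \in path_edges u p -> e \subset D.
Proof. by move=> pD ep; apply/subsetP => z /(path_edges_vertex ep)/pD. Qed.

Lemma eq_rainbow_within c c' D k u v :
  (forall e : {set G}, e \subset D -> c e = c' e) ->
  rainbow_within c D k u v -> rainbow_within c' D k u v.
Proof.
move=> cc' [p [up pD Uc kc]]; exists p.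
have <- : [seq c e | e <- path_edges u p] = [seq c' e | e <- path_edges u p].
  by apply/eq_in_map => e /(path_edges_subset pD)/cc'.
by split.
Qed.

Lemma rainbow_within_mono c D D' k k' u v :
  D \subset D' -> k <= k' ->
  rainbow_within c D k u v -> rainbow_within c D' k' u v.
Proof.
move=> /subsetP DD' kk' [p [up pD Uc kc]]; exists p; split=> //.
  by move=> z /pD/DD'.
by apply: sub_all kc => i /= /leq_trans; apply.
Qed.

Lemma rainbow_within_refl c D k u : u \in D -> rainbow_within c D k u u.
Proof. by move=> uD; exists [::]; split=> // z; rewrite inE => /eqP->. Qed.

(** * Spanning trees with distinct edge colors *)

Inductive connected_set : {set G} -> Prop :=
| Connected_set1 v : connected_set [set v]
| Connected_setU v w D :
    connected_set D -> w \in D -> adj v w -> connected_set (v |: D).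

(** A derivation of [connected_set] grows a spanning tree: each new vertex is a leaf whose edge
    receives a fresh color. *)
Lemma tree_coloring D : connected_set D ->
  exists c, (forall e, c e < #|D|) /\
    {in D &, forall u v, rainbow_within c D #|D|.-1 u v}.
Proof.
elim=> [v|v w {}D _ [c [cD cP]] wD vw].
  exists (fun=> 0); split=> [_|u u']; first by rewrite cards1.
  by rewrite !inE => /eqP-> /eqP->; apply: rainbow_within_refl; rewrite inE.
case: (boolP (v \in D)) => vD; first by rewrite (setUidPr _) ?sub1set //; exists c.
(* Edges at the new leaf [v] get the first color beyond the bound for paths inside [D]. *)
pose c' (e : {set G}) := if v \in e then #|D|.-1 else c e.
have D0 : 0 < #|D| by apply/card_gt0P; exists w.
have cc' (e : {set G}) : e \subset D -> c e = c' e.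
  by move=> /subsetP eD; rewrite /c'; case: ifP => // /eD; rewrite (negPf vD).
have c'P u u' : u \in D -> u' \in D -> rainbow_within c' D #|D|.-1 u u'.
  by move=> uD u'D; apply: eq_rainbow_within cc' _; apply: cP.
have vP u : u \in D -> rainbow_within c' (v |: D) #|D| v u.
  move=> uD; apply: rainbow_within_cons vw vD _ (c'P _ _ wD uD).
  by rewrite /c' !inE eqxx leqnn prednK /=.
exists c'; rewrite cardsU1 vD /=; split=> [e|u u'].
  by rewrite /c'; have := cD e; case: ifP; lia.
rewrite !inE => /predU1P[->|uD] /predU1P[->|u'D].
- by apply: rainbow_within_refl; rewrite !inE eqxx.
- exact: vP.
- exact/rainbow_within_sym/vP.
- by apply: rainbow_within_mono (c'P _ _ uD u'D); rewrite ?subsetUr ?leq_pred.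
Qed.

(** * A vertex whose non-neighbors become connected by adding one neighbor *)

Definition nbrs x : {set G} := [set y | adj x y].

Definition non_nbrs x : {set G} := ~: (x |: nbrs x).

Lemma in_non_nbrs x y : (y \in non_nbrs x) = (y != x) && ~~ adj x y.
Proof. by rewrite !inE negb_or. Qed.

Lemma path_exits D x p : path (@adj G) x p -> x \in D -> last x p \notin D ->
  exists u v, [/\ u \in D, v \notin D & adj u v].
Proof.
elim: p x => [|y p IH] x /=; first by move=> _ ->.
move=> /andP[xy yp] xD lD; case: (boolP (y \in D)) => yD; first exact: IH yp yD lD.
by exists x, y.
Qed.

Lemma connected_non_nbrs : connected_graph G ->
  (forall u v, u != v -> adj u v) \/
  exists x h, adj x h /\ connected_set (h |: non_nbrs x).
Proof.
case=> _ conG.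
have [complete|/existsNP[u /existsNP[v /not_implyP[uv /negP nuv]]]] :=
  pselect (forall u v, u != v -> adj u v); [by left | right].
pose good k := `[< exists x K, [/\ connected_set K, K \subset non_nbrs x & #|K| = k] >].
have good1 : exists k, good k.
  exists 1; apply/asboolP; exists u, [set v]; split; last by rewrite cards1.
    exact: Connected_set1.
  by rewrite sub1set in_non_nbrs eq_sym uv.
have good_le k : good k -> k <= #|G|.
  by move=> /asboolP[x [K [_ _ <-]]]; apply: max_card.
have [k /asboolP[x [K [conK KM Kk]]] max_k] := ex_maxnP good1 good_le.
have maxK x' K' : connected_set K' -> K' \subset non_nbrs x' -> #|K'| <= #|K|.
  by move=> conK' K'M; rewrite Kk; apply: max_k; apply/asboolP; exists x', K'.
(* Maximality ranges over all base vertices [x'], so it can later be used with [z] in place of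
   [x]. *)
have maxKU x' w t : w \notin K -> t \in K -> adj w t -> ~~ (w |: K \subset non_nbrs x').
  move=> wK tK wt; apply/negP => /(maxK _ _ (Connected_setU conK tK wt)).
  by rewrite cardsU1 wK ltnn.
have [t tK] : exists t, t \in K.
  by case: conK => [w|w w' D _ _ _]; exists w; rewrite !inE eqxx.
have xK : x \notin K.
  by apply/negP => /(subsetP KM); rewrite in_non_nbrs eqxx.
(* A path from [t] to [x] leaves [K] along some edge from [t'] to [h]. By maximality [h] is [x] or
   adjacent to [x], and it is not [x] because [t'] is not adjacent to [x]. *)
have [p [tp _ lp]] := conG t x.
have [||t' [h [t'K hK t'h]]] := path_exits (D := K) tp; rewrite ?lp //.
have ht' : adj h t' by rewrite adj_sym.
have xh : adj x h.
  have := maxKU x _ _ hK t'K ht'; rewrite subUset KM andbT sub1set in_non_nbrs.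
  rewrite negb_and !negbK => /orP[/eqP hx|//].
  have := subsetP KM _ t'K; rewrite in_non_nbrs -hx ht' andbF //.
exists x, h; split=> //.
have zh z : z \in non_nbrs x -> z \notin K -> adj z h.
  move=> zM zK.
  have zK' w : w \in K -> ~~ adj z w.
    move=> wK; apply/negP => zw.
    by have := maxKU x _ _ zK wK zw; rewrite subUset KM sub1set zM.
  (* With base vertex [z], the set [h |: K] is too large, so one of its members is [z] or adjacent
     to [z]; every case but [adj z h] is contradictory. *)
  have := maxKU z _ _ hK t'K ht'; rewrite subUset negb_and sub1set in_non_nbrs.
  rewrite negb_and !negbK => /orP[/orP[/eqP hz|//]|/subsetPn[w wK]].
    by move: zM; rewrite -hz in_non_nbrs xh andbF.
  rewrite in_non_nbrs zK' // andbT negbK => /eqP wz.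
  by rewrite -wz wK in zK.
(* The other non-neighbors join one at a time, each already in [K] or adjacent to [h]. *)
have extend (s : seq G) : {subset s <= non_nbrs x} ->
    connected_set (h |: K :|: [set z in s]).
  elim: s => [_|z s IH sM].
    have -> : [set z in [::]] = set0 :> {set G} by apply/setP=> z; rewrite !inE.
    by rewrite setU0; apply: Connected_setU ht'.
  have /IH conD : {subset s <= non_nbrs x} by move=> w ws; apply: sM; rewrite inE ws orbT.
  rewrite set_cons setUCA.
  case: (boolP (z \in K)) => zK; first by rewrite (setUidPr _) // sub1set !inE zK orbT.
  apply: (Connected_setU (w := h)) => //; first by rewrite !inE eqxx.
  by apply: zh => //; apply: sM; rewrite mem_head.
have := extend (enum (non_nbrs x)); rewrite set_enum -setUA (setUidPr KM); apply.
by move=> z; rewrite mem_enum.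
Qed.

(** * Degree counts *)

Lemma min_degree_le x : min_degree G <= degree x.
Proof.
rewrite /min_degree; elim: index_enum (mem_index_enum x) => //= y s IH.
rewrite big_cons inE geq_min => /predU1P[->|/IH->]; first by rewrite leqnn.
by rewrite orbT.
Qed.

Lemma card_nbrs_non_nbrs x : #|G| = (degree x + #|non_nbrs x|).+1.
Proof.
have := cardsC (x |: nbrs x); rewrite cardsU1 inE adj_irr /= => <-.
by rewrite /degree /non_nbrs /nbrs.
Qed.

(** Both degrees count the [a] common neighbors. Besides these, [degree x] counts [y] and the
    non-neighbors of [y], while [degree y] counts [x] and the neighbors in [non_nbrs x]. *)
Lemma degree_non_nbrs x y : adj x y ->
  #|[set z | [&& adj x z, z != y & ~~ adj y z]]| + degree y
    <= degree x + #|nbrs y :&: non_nbrs x|.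
Proof.
move=> xy; set t := #|_|.
pose a := #|nbrs x :&: nbrs y|.
have dx : degree x = (t + a).+1.
  rewrite /degree -/(nbrs x) (cardsD1 y) inE xy add1n -(cardsID (nbrs y)) addnC.
  congr (_ + _).+1; apply: eq_card => z; rewrite !inE.
    by case: (adj x z); case: (adj y z); rewrite ?andbF ?andbT.
  by case: eqP => [->|//]; rewrite adj_irr !andbF.
have dy : degree y = (a + #|nbrs y :&: non_nbrs x|).+1.
  rewrite /degree -/(nbrs y) (cardsD1 x) inE adj_sym xy add1n -(cardsID (nbrs x)).
  congr (_ + _).+1; apply: eq_card => z; rewrite !inE.
    by case: eqP => [->|_]; rewrite ?adj_irr ?andbF // andbC.
  by case: (adj x z); case: (z == x); case: (adj y z).
by rewrite dx dy; lia.
Qed.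

(** * The coloring and its rainbow paths *)

Lemma rainbow_colorable_complete :
  (forall u v, u != v -> adj u v) -> rainbow_colorable G 1.
Proof.
move=> complete; exists (fun=> 0); split=> // x y.
have [->|xy] := eqVneq x y; first by exists [::].
by exists [:: y]; split=> //; split=> //=; rewrite ?complete // inE xy.
Qed.

Lemma rainbow_colorable_min_degree :
  connected_graph G -> rainbow_colorable G (#|G| - min_degree G).
Proof.
move=> conG; set k := #|G| - min_degree G.
have [complete|[x [h [xh conD]]]] := connected_non_nbrs conG.
  have [/card_gt0P[x _] _] := conG.
  have [c [cP cR]] := rainbow_colorable_complete complete.
  exists c; split=> // e /cP /leq_trans; apply.
  by have := min_degree_le x; have := card_nbrs_non_nbrs x; rewrite /k; lia.
set M := non_nbrs x in conD; set D := h |: M in conD.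
have hM : h \notin M by rewrite in_non_nbrs xh andbF.
have cardD : #|D| = #|M|.+1 by rewrite cardsU1 hM.
have hD : h \in D by rewrite !inE eqxx.
have xM : x \notin M by rewrite in_non_nbrs eqxx.
have xD : x \notin D.
  by rewrite in_setU1 negb_or xM andbT; apply: contraTneq xh => ->; rewrite adj_irr.
have [ct [ctD ctP]] := tree_coloring conD; rewrite cardD /= in ctD ctP.
(* Conflicting vertices will be joined through [x], so their edges to [x] must differ in color. *)
pose e y z := [&& adj x y, adj x z, z != y & ~~ adj y z].
have e_sym : symmetric e.
  by move=> y z; rewrite /e eq_sym [adj y z]adj_sym; case: (adj x y); case: (adj x z).
have e_irr : irreflexive e by move=> y; rewrite /e eqxx !andbF.
(* Tree paths use colors below [#|M|]. The short list has [degree x - min_degree G + 1] colors,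
   enough for a [y] without neighbors in [M]; any other [y] has at most [#|M|] more conflicts,
   matched by the [#|M|] extra colors. *)
pose L y := if nbrs y :&: M == set0 then iota #|M| (k - #|M|) else iota 0 k.
pose s := enum (nbrs x :\ h).
have mem_s y : (y \in s) = (y != h) && adj x y by rewrite mem_enum !inE.
have hs : h \notin s by rewrite mem_s eqxx.
have nG := card_nbrs_non_nbrs x; rewrite -/M in nG.
have deg_x := min_degree_le x.
have Mk : #|M| < k by rewrite /k; lia.
have Ls y : y \in s -> uniq (L y) /\ #|[set z | e y z]| < size (L y).
  rewrite mem_s => /andP[_ xy]; split; first by rewrite /L; case: ifP; rewrite iota_uniq.
  have -> : [set z | e y z] = [set z | [&& adj x z, z != y & ~~ adj y z]].
    by apply/setP => z; rewrite !inE /e xy.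
  have := degree_non_nbrs xy; have := min_degree_le y; rewrite -/M /L.
  case: eqP => [->|_]; rewrite size_iota ?cards0 /k; first by lia.
  by have := subset_leq_card (subsetIr (nbrs y) M); lia.
have [c [ch cL cP]] := greedy_list_coloring #|M| e_sym e_irr hs Ls.
have mem_hs y : adj x y -> y \in h :: s by rewrite inE mem_s => ->; case: eqP.
have c_lt y : adj x y -> c y < k.
  move=> /mem_hs; rewrite inE => /predU1P[->|/cL]; first by rewrite ch.
  by rewrite /L; case: ifP; rewrite mem_iota; lia.
have c_neq y z : adj x y -> adj x z -> z != y -> ~~ adj y z -> c y != c z.
  by move=> xy xz zy yz; apply: cP; rewrite ?mem_hs // /e xy xz zy.
(* On an edge at [x] the pick finds the other end, so the default [x] is not reached. *)
pose C (e : {set G}) :=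
  if x \in e then c (odflt x [pick y in e :\ x])
  else if e \subset D then ct e else #|M|.
have Cx y : adj x y -> C [set x; y] = c y.
  move=> xy; rewrite /C !inE eqxx /=; case: pickP => [z|/(_ y)].
    by rewrite !inE => /andP[/negPf-> /eqP->].
  by rewrite !inE eqxx orbT andbT eq_sym; case: eqP xy => // <-; rewrite adj_irr.
have Cx' y : adj x y -> C [set y; x] = c y by rewrite setUC; apply: Cx.
have Cout y z : adj x y -> y \notin D -> z != x -> C [set y; z] = #|M|.
  move=> xy yD zx; rewrite /C !inE [x == z]eq_sym (negPf zx) orbF.
  case: eqP xy => [->|_ _]; first by rewrite adj_irr.
  by rewrite subUset sub1set (negPf yD).
have CD u v : u \in D -> v \in D -> rainbow_within C D #|M| u v.
  move=> uD vD; apply: eq_rainbow_within (ctP u v uD vD) => f fD.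
  by rewrite /C fD; case: ifP => // /(subsetP fD); rewrite (negPf xD).
pose rainbow u v := exists E j, rainbow_within C E j u v.
have rainbow_sym u v : rainbow u v -> rainbow v u.
  by case=> E [j /rainbow_within_sym]; exists E, j.
have rainbow_refl u : rainbow u u.
  by exists [set u], 0; apply: rainbow_within_refl; rewrite inE.
have rainbow_adj u v : adj u v -> rainbow u v.
  move=> uv; exists (u |: [set v]), (C [set u; v]).+1.
  apply: (rainbow_within_cons (k := 0) (w := v)); rewrite ?inE ?leqnn //=.
    by apply: contraTneq uv => ->; rewrite adj_irr.
  by apply: rainbow_within_refl; rewrite inE.
have rainbow_xD v : v \in D -> rainbow_within C (x |: D) #|M|.+1 x v.
  by move=> vD; apply: rainbow_within_cons (CD h v hD vD); rewrite ?Cx ?ch ?leqnn /=.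
have D_or_s y : y != x -> y \notin D -> adj x y && (y != h).
  by rewrite in_setU1 in_non_nbrs => ->; rewrite negb_or negbK andbC.
have rainbow_sD y v : adj x y -> y \notin D -> v \in D -> rainbow y v.
  move=> xy yD vD; have yx : y != x by apply: contraTneq xy => ->; rewrite adj_irr.
  case: (boolP [exists w in D, adj y w]) => [/exists_inP[w wD yw]|].
    (* The edge [yw] has color [#|M|], and a tree path from [w] to [v] follows. *)
    exists (y |: D), #|M|.+1.
    apply: (rainbow_within_cons yw yD _ (CD w v wD vD)).
    by rewrite Cout ?leqnn ?ltnSn //; apply: contraNneq xD => <-.
  rewrite negb_exists_in => /forall_inP nyD.
  have yh : y != h by apply: contraNneq yD => ->.
  have ys : y \in s by rewrite mem_s yh.
  have NM0 : nbrs y :&: M == set0.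
    apply/set0Pn => -[w]; rewrite in_setI inE => /andP[yw wM].
    by have := nyD w; rewrite in_setU1 wM orbT yw => /(_ isT).
  (* The list gives [#|M| <= c y], and equality fails since [h], colored [#|M|], is not adjacent to
     [y]. So [y], [x], [h] and then a tree path to [v] form a rainbow path. *)
  have Mc : #|M| < c y.
    have := cL y ys; rewrite /L NM0 mem_iota => /andP[My _].
    by rewrite ltn_neqAle My andbT -ch c_neq // adj_sym nyD.
  exists (y |: (x |: D)), (c y).+1.
  apply: rainbow_within_cons (rainbow_xD v vD); first by rewrite adj_sym.
    by rewrite in_setU1 negb_or yx.
  by rewrite Cx' // Mc /=.
have rainbow_ss y z : adj x y -> adj x z -> rainbow y z.
  move=> xy xz; have [->//|zy] := eqVneq z y.
  case: (boolP (adj y z)) => [/rainbow_adj//|yz].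
  have nx w : adj x w -> x != w by move=> xw; apply: contraTneq xw => <-; rewrite adj_irr.
  exists setT, k, [:: x; z]; split=> [|w _||] /=.
  - split; rewrite //= ?[adj y x]adj_sym ?xy ?xz //.
    by rewrite !inE negb_or [y == x]eq_sym [y == z]eq_sym !nx ?zy.
  - by rewrite inE.
  - by rewrite Cx // Cx' // inE c_neq.
  - by rewrite Cx // Cx' // !c_lt.
have rainbow_x v : rainbow x v.
  have [->//|vx] := eqVneq v x.
  case: (boolP (v \in D)) => [/rainbow_xD|vD]; first by exists (x |: D), #|M|.+1.
  by have /andP[/rainbow_adj] := D_or_s v vx vD.
exists C; split=> [f|u v].
  rewrite inE => /existsP[y /existsP[z /andP[yz /eqP->]]].
  case: (eqVneq x y) yz => [<- yz|yx yz]; first by rewrite Cx ?c_lt.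
  case: (eqVneq x z) yz => [<-|zx _]; first by rewrite adj_sym => xy; rewrite Cx' ?c_lt.
  rewrite /C !inE (negPf yx) (negPf zx) /=; case: ifP => // _.
  exact: leq_trans (ctD _) Mk.
suff [E [j [p [up _ Up _]]]] : rainbow u v by exists p.
have [->//|ux] := eqVneq u x.
have [->|vx] := eqVneq v x; first exact: rainbow_sym.
(* Apart from [x], a vertex lies in [D] or is a neighbor of [x] other than [h]. *)
case: (boolP (u \in D)) => uD; case: (boolP (v \in D)) => vD.
- by exists D, #|M|; apply: CD.
- by have /andP[xv _] := D_or_s v vx vD; apply/rainbow_sym/rainbow_sD.
- by have /andP[xu _] := D_or_s u ux uD; apply: rainbow_sD.
have /andP[xu _] := D_or_s u ux uD; have /andP[xv _] := D_or_s v vx vD.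
exact: rainbow_ss.
Qed.

End Rainbow.

Theorem proposition1p1 (G : sgraph) (conG : connected_graph G) :
  rc conG <= #|G| - min_degree G.
Proof.
rewrite /rc; case: ex_minnP => k _; apply.
exact/asboolP/rainbow_colorable_min_degree.
Qed.
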